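(* For integers $k \ge 1$ let $w(k) = \sum_{n=1}^{k} \arctan\left(\frac{1}{\sqrt{n}}\right)$. The angle on the Square Root Spiral between the two radii of integer lengths $k$ and $k+3$ (that is, between the square numbers $k^2$ and $(k+3)^2$ lying on two successive winds), measured up to a full rotation, converges to $2\pi - 6$: $$\lim_{k\to\infty} \Bigl(2\pi - \bigl(w((k+3)^2) - w(k^2)\bigr)\Bigr) = 2\pi - 6,$$ which in degrees is $360^\circ - 3\cdot \frac{360^\circ}{\pi}$.
   Context: The Square Root Spiral (spiral of Theodorus) is built from right-angled triangles with a common vertex (the center): the $n$-th triangle ($n\ge 1$) has legs (cathets) of lengths $\sqrt n$ and $1$ and hypotenuse $\sqrt{n+1}$, the longer leg of each next triangle being the hypotenuse of the previous one. The angle of the $n$-th triangle at the center is $\arctan(1/\sqrt n)$, and $w(k)$ is the cumulative angle (in radians) of the first $k$ triangles. *)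

(* Defs.v *)
(* Stdlib reals with Coquelicot. *)
From Stdlib Require Import Reals.
From Coquelicot Require Import Coquelicot.
Open Scope R_scope.

(* Angle at the center of the n-th right triangle (n >= 1), whose legs are
   sqrt n (along the radius) and 1. *)
Definition triangle_angle (n : nat) : R := atan (1 / sqrt (INR n)).

(* Cumulative angle, in radians, of triangles 1, ..., k; [w 0 = 0]. *)
Definition w (k : nat) : R := sum_n_m triangle_angle 1 k.

(* Main.v *)
Require Import Defs.
From Stdlib Require Import Reals Lra Lia.
From Coquelicot Require Import Coquelicot.
Open Scope R_scope.

(** Between the radii [k] and [k + m] there are [2mk + m^2] triangles, whose
    angles all lie between [atan (1 / (k + m))] and [atan (1 / k)].  For small
    [y] the angle [atan y] is [y] up to a factor tending to 1, so the total
    angle is asymptotic to [2mk / k = 2m].  The elementary bounds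
    [y / (1 + y^2) <= atan y <= y] make this precise
    ([w_square_increment_bounds]) and a squeeze gives the limit [2m]
    ([w_square_increment_lim]); three steps give the angle 6. *)

(** By the mean value theorem [atan y = y / (1 + c^2)] for some [c] between
    [0] and [y]. *)
Lemma atan_bounds (y : R) : 0 <= y -> y / (1 + y ^ 2) <= atan y <= y.
Proof.
intros Hy.
destruct (MVT_gen atan 0 y (fun x => / (1 + x ^ 2))) as [c [Hc Heq]].
- intros x _; apply is_derive_Reals.
  apply derivable_pt_lim_atan.
- intros x _; apply derivable_continuous_pt, derivable_pt_atan.
- rewrite Rmin_left, Rmax_right in Hc by lra.
  rewrite atan_0, !Rminus_0_r in Heq; rewrite Heq.
  assert (H1 : / (1 + y ^ 2) <= / (1 + c ^ 2))
    by (apply Rinv_le_contravar; nra).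
  assert (H2 : / (1 + c ^ 2) <= 1)
    by (rewrite <- Rinv_1 at 2; apply Rinv_le_contravar; nra).
  unfold Rdiv; nra.
Qed.

Lemma w_increment_bounds (lo hi : R) (a d : nat) :
  (forall n, (a < n <= a + d)%nat -> lo <= triangle_angle n <= hi) ->
  INR d * lo <= w (a + d) - w a <= INR d * hi.
Proof.
induction d as [|d IH]; intros H.
- rewrite Nat.add_0_r; simpl; lra.
- assert (HS : w (a + S d) = w (a + d) + triangle_angle (a + S d)).
  { rewrite Nat.add_succ_r; unfold w; rewrite sum_n_Sm by lia; reflexivity. }
  assert (Hlast := H (a + S d)%nat ltac:(lia)).
  assert (IH' := IH ltac:(intros n Hn; apply H; lia)).
  rewrite HS, S_INR; lra.
Qed.

Lemma triangle_angle_bounds (p q n : nat) :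
  (0 < p)%nat -> (p ^ 2 <= n <= q ^ 2)%nat ->
  atan (/ INR q) <= triangle_angle n <= atan (/ INR p).
Proof.
intros Hp [Hpn Hnq].
apply le_INR in Hpn; apply le_INR in Hnq; rewrite pow_INR in Hpn, Hnq.
assert (Hp0 := lt_0_INR p Hp); assert (Hq0 := pos_INR q).
assert (Hp_sqrt : INR p <= sqrt (INR n)).
{ rewrite <- (sqrt_pow2 (INR p)) by lra; now apply sqrt_le_1_alt. }
assert (Hq_sqrt : sqrt (INR n) <= INR q).
{ rewrite <- (sqrt_pow2 (INR q)) by lra; now apply sqrt_le_1_alt. }
unfold triangle_angle, Rdiv; rewrite Rmult_1_l.
assert (atan_le : forall x y, x <= y -> atan x <= atan y).
{ intros x y [Hxy | ->]; [left; now apply atan_increasing | right; reflexivity]. }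
split; apply atan_le, Rinv_le_contravar; lra.
Qed.

(** Each bound is the number [2mk + m^2] of triangles times a bound on a single
    angle.  Writing that number as [k (2m + m^2 / k)] above and as
    [(k + m) (2m - m^2 / (k + m))] below cancels the growing factor. *)
Lemma w_square_increment_bounds (m k : nat) :
  (0 < k)%nat ->
  (2 * INR m - INR m ^ 2 * / INR (k + m)) / (1 + (/ INR (k + m)) ^ 2)
    <= w ((k + m) ^ 2) - w (k ^ 2)
    <= 2 * INR m + INR m ^ 2 * / INR k.
Proof.
intros Hk.
set (d := (2 * m * k + m ^ 2)%nat).
assert (Hd : ((k + m) ^ 2 = k ^ 2 + d)%nat) by (unfold d; simpl; ring).
assert (HdR : INR d = 2 * INR m * INR k + INR m ^ 2).
{ unfold d; rewrite plus_INR, !mult_INR, pow_INR; simpl; ring. }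
assert (Hk0 := lt_0_INR k Hk); assert (Hm0 := pos_INR m).
assert (Hkm := plus_INR k m).
destruct (w_increment_bounds (atan (/ INR (k + m))) (atan (/ INR k)) (k ^ 2) d)
  as [Hlo Hhi].
{ intros n Hn; apply triangle_angle_bounds; lia. }
rewrite <- Hd in Hlo, Hhi.
assert (Hd0 := pos_INR d).
assert (Hinv : forall j, (0 < j)%nat -> 0 <= / INR j).
{ intros j Hj; left; now apply Rinv_0_lt_compat, lt_0_INR. }
split.
- eapply Rle_trans, Hlo.
  eapply Rle_trans; [right | apply Rmult_le_compat_l; [exact Hd0 |]].
  2: exact (proj1 (atan_bounds _ (Hinv (k + m)%nat ltac:(lia)))).
  rewrite HdR, Hkm; field; split; nra.
- eapply Rle_trans; [exact Hhi |].
  eapply Rle_trans; [apply Rmult_le_compat_l; [exact Hd0 |] | right].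
  1: exact (proj2 (atan_bounds _ (Hinv k Hk))).
  rewrite HdR; field; lra.
Qed.

Lemma is_lim_seq_inv_INR : is_lim_seq (fun k => / INR k) 0.
Proof.
apply (is_lim_seq_inv INR p_infty); [apply is_lim_seq_INR | discriminate].
Qed.

Theorem w_square_increment_lim (m : nat) :
  is_lim_seq (fun k => w ((k + m) ^ 2) - w (k ^ 2)) (2 * INR m).
Proof.
apply is_lim_seq_le_le_loc with
  (u := fun k => (2 * INR m - INR m ^ 2 * / INR (k + m))
                 / (1 + (/ INR (k + m)) ^ 2))
  (w := fun k => 2 * INR m + INR m ^ 2 * / INR k).
- exists 1%nat; intros k Hk; apply w_square_increment_bounds; lia.
- (* The lower bound is a function of [/ INR (k + m)] continuous at 0. *)
  replace (Finite (2 * INR m))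
    with (Finite ((2 * INR m - INR m ^ 2 * 0) / (1 + 0 ^ 2)))
    by (f_equal; field).
  apply (is_lim_seq_continuous
    (fun y => (2 * INR m - INR m ^ 2 * y) / (1 + y ^ 2))
    (fun k => / INR (k + m)) 0).
  + apply derivable_continuous_pt, ex_derive_Reals_0.
    auto_derive; lra.
  + now apply (is_lim_seq_incr_n (fun k => / INR k)), is_lim_seq_inv_INR.
- replace (Finite (2 * INR m)) with (Finite (2 * INR m + INR m ^ 2 * 0))
    by (f_equal; ring).
  apply is_lim_seq_plus'; [apply is_lim_seq_const |].
  apply (is_lim_seq_scal_l _ _ (Finite 0)), is_lim_seq_inv_INR.
Qed.

Theorem mainTheorem3 :
  is_lim_seq
    (fun k : nat => 2 * PI - (w ((k + 3) ^ 2)%nat - w (k ^ 2)%nat))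
    (Finite (2 * PI - 6))
  /\ toDeg (2 * PI - 6) = 360 - 3 * (360 / PI).
Proof.
split.
- apply is_lim_seq_minus'; [apply is_lim_seq_const |].
  replace 6 with (2 * INR 3) by (simpl; ring).
  apply w_square_increment_lim.
- unfold toDeg, plat; field; apply PI_neq0.
Qed.
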